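(* Let $X=(\mathrm{o};0\,|\,b;(\alpha_1,\beta_1),\dots,(\alpha_n,\beta_n))$ be a Seifert fibered rational homology sphere with base $S^2$, $n\ge3$ exceptional fibers and Seifert Euler number $E=-b-\sum_{j=1}^n\beta_j/\alpha_j\ne0$, and put $\mathcal{A}=\prod_{j=1}^n\alpha_j$. Let $\tau_r^0(X)$ be the contribution of the trivial connection to the large $r$ asymptotic expansion of the $\mathrm{SU}(2)$ Reshetikhin--Turaev invariant $\tau_r(X)$, i.e. the formal expansion $$\tau_r^0(X)=\frac{2}{\sqrt{r\mathcal{A}}}\,e^{-\frac{3\pi i}4\mathrm{sign}(E)}\exp\Bigl(\frac{i\pi}{2r}\Bigl[3\,\mathrm{sign}(E)-E-\sum_{j=1}^nS\Bigl(\frac{\beta_j}{\alpha_j}\Bigr)\Bigr]\Bigr)\sum_{k=k_1}^\infty c_kr^{-k}$$ with $k_1=-\lfloor (n-2)/2\rfloor$ and $$c_k=\frac1{\pi^{n-2}}\frac{e^{\frac{i\pi}4\mathrm{sign}(E)}}{\sqrt{2\pi|E|}}\frac{\Gamma(k+\frac12)}{(2k+n-2)!}\Bigl(\frac{2i}{\pi E}\Bigr)^k\partial_z^{(2k+n-2)}\Bigl\{\Bigl(\frac{\pi z}{\sin(\pi z)}\Bigr)^{n-2}\prod_{j=1}^n\sin\Bigl(\frac{\pi z}{\alpha_j}\Bigr)\Bigr\}\Big|_{z=0}.$$ Then there are constants $b_2,b_3,\dots\in\mathbb{C}$ (independent of $r$) such that, as formal expansions, $$\tau_r^0(X)=\frac{\pi}{|E|\mathcal{A}}\sqrt{\frac{2}{|E|\mathcal{A}}}\;r^{-3/2}\Bigl(1+6\pi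 i\,\lambda_{\mathrm{CW}}(X)\,r^{-1}+b_2r^{-2}+b_3r^{-3}+\cdots\Bigr),$$ where $\lambda_{\mathrm{CW}}(X)$ is the Casson--Walker invariant of $X$.
   Context: $(\alpha_j,\beta_j)$ are coprime pairs with $0<\beta_j<\alpha_j$, $b\in\mathbb{Z}$; $-b$ is the Euler number of the circle bundle $(\mathrm{o};0\,|\,b)$ over $S^2$. $\tau_r$ is the Reshetikhin--Turaev invariant at level $r-2$, normalized by $\tau_r(S^3)=\sqrt{2/r}\sin(\pi/r)$ and $\tau_r(S^2\times S^1)=1$. The full asymptotic expansion of $\tau_r(X)$ is a finite sum of terms indexed by index sets which parametrize (families of) flat $\mathrm{SU}(2)$-connections; the trivial connection corresponds to one index (denoted $(l,n')=(0,0)$), and $\tau^0_r(X)$ displayed in the claim is the term for this index. $S(d/c)=12\,\mathrm{sign}(c)\,\mathrm{s}(d,c)$ is the Dedekind symbol, with $\mathrm{s}(d,c)=\frac1{4|c|}\sum_{j=1}^{|c|-1}\cot\frac{\pi j}c\cot\frac{\pi dj}c$ for $|c|>1$, $\mathrm{s}(d,\pm1)=0$. $\lambda_{\mathrm{CW}}$ is Walker's extension of the Casson invariant to rational homology spheres; for the Seifert fibered rational homology sphere $X=(\mathrm{o};0\,|\,b;(\alpha_1,\beta_1),\dots,(\alpha_n,\beta_n))$ with base $S^2$ and Seifert Euler number $E=-b-\sum_{j=1}^n\beta_j/\alpha_j\ne0$, Lescop's known formula gives $$\lambda_{\mathrm{CW}}(X)=\frac1{12}\Bigl(3\,\mathrm{sign}(E)-E-\sum_{j=1}^nS\Bigl(\frac{\beta_j}{\alpha_j}\Bigr)-\frac1E\Bigl(2-n+\sum_{j=1}^n\frac1{\alpha_j^2}\Bigr)\Bigr).$$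 *)

(* Defs.v *)
From HB Require Import structures.
From mathcomp Require Import all_boot all_order all_algebra.
From mathcomp Require Import all_classical all_reals all_analysis.
From mathcomp Require Import complex.

Set Implicit Arguments.
Unset Strict Implicit.
Unset Printing Implicit Defensive.

Import Order.TTheory GRing.Theory Num.Theory.
Import numFieldNormedType.Exports.

Local Open Scope classical_set_scope.
Local Open Scope complex_scope.
Local Open Scope ring_scope.

(** Formal expansions for r -> oo: FExp v a stands for the formal series
    \sum_(j >= 0) a_j r^(-(v + j)/2), i.e. a formal Laurent series in r^(-1/2).
    The order v is only a lower bound for the support, so expansions are compared
    by their coefficients (fexp_eq), not by Leibniz equality. *)
Record fexp (K : Type) := FExp { fexp_ord : int; fexp_seq : nat -> K }.

Section FormalExpansions.
Variable K : fieldType.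
Implicit Types f g : fexp K.

(** The coefficient of r^(-m/2). *)
Definition fexp_coef f (m : int) : K :=
  if fexp_ord f <= m then fexp_seq f `|(m - fexp_ord f)%R|%N else 0.

Definition fexp_eq f g : Prop := forall m, fexp_coef f m = fexp_coef g m.

Definition fexp_mul f g : fexp K :=
  FExp (fexp_ord f + fexp_ord g)
       (fun j => \sum_(i < j.+1) fexp_seq f i * fexp_seq g (j - i)%N).

(** c r^(-m/2) *)
Definition fexp_mono (c : K) (m : int) : fexp K :=
  FExp m (fun j => if j == 0%N then c else 0).

(** \sum_(j >= 0) c_j r^(-(k1 + j)): integral powers of r^-1 only. *)
Definition fexp_rinv (k1 : int) (c : nat -> K) : fexp K :=
  FExp (k1 *+ 2) (fun j => if odd j then 0 else c j./2).

(** exp(a r^-1) *)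
Definition fexp_exp (a : K) : fexp K := fexp_rinv 0 (fun j => a ^+ j / j`!%:R).

End FormalExpansions.

Notation "f ** g" := (fexp_mul f g) (at level 40, left associativity).
Notation "f ~~~ g" := (fexp_eq f g) (at level 70, no associativity).

Section Functions.
Variable R : realType.

(** e^(i theta) *)
Definition cis (theta : R) : R[i] := cos theta +i* sin theta.

Definition gamma_integral (x : R) : R :=
  Rintegral (@lebesgue_measure R) `]0, +oo[ (fun t => t `^ (x - 1) * expR (- t)).

(** Euler's integral for x > 0, extended to x <= 0 by the functional equation
    Gamma(x) = Gamma(x + N) / (x (x + 1) ... (x + N - 1)) with x + N > 0; the
    value at the poles 0, -1, -2, ... is irrelevant. *)
Definition Gamma (x : R) : R :=
  if 0 < x then gamma_integral x
  else let N := (Num.truncn (- x)).+1 in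
       gamma_integral (x + N%:R) / \prod_(j < N) (x + j%:R).

(** The function pi z / sin(pi z), with its removable singularity at 0 filled. *)
Definition pi_csc (z : R) : R := if z == 0 then 1 else pi * z / sin (pi * z).

Definition cot (x : R) : R := cos x / sin x.

(** s(d, c); the sum is empty for c = 1 and c = -1. *)
Definition dedekind_sum (d c : int) : R :=
  (4 * `|c%:~R|)^-1 *
  \sum_(1 <= j < `|c|%N) cot (pi * j%:R / c%:~R) * cot (pi * d%:~R * j%:R / c%:~R).

(** The Dedekind symbol S(d/c). *)
Definition dedekind_symbol (d c : int) : R :=
  12 * Num.sg c%:~R * dedekind_sum d c.

End Functions.

(** Normalized Seifert invariants (o; 0 | b; (alpha_1, beta_1), ..., (alpha_n, beta_n)). *)
Record seifert := Seifert {
  sf_n : nat;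
  sf_b : int;
  sf_alpha : 'I_sf_n -> nat;
  sf_beta : 'I_sf_n -> nat;
  sf_coprime : forall j, coprime (sf_alpha j) (sf_beta j);
  sf_normalized : forall j, (0 < sf_beta j < sf_alpha j)%N }.

Section Seifert.
Variables (R : realType) (X : seifert).

Local Notation n := (sf_n X).
Local Notation alpha j := ((@sf_alpha X j)%:R : R).
Local Notation beta j := ((@sf_beta X j)%:R : R).
Local Notation S j := (dedekind_symbol R (@sf_beta X j) (@sf_alpha X j)).

(** E. The closed manifold X is a rational homology sphere iff E != 0. *)
Definition seifert_euler : R := - (sf_b X)%:~R - \sum_j beta j / alpha j.

Local Notation E := seifert_euler.

Definition seifert_A : R := \prod_j alpha j.

(** The Casson-Walker invariant, in Walker's normalization. 3-manifolds and their
    surgery theory are not available here, so it is defined by Lescop's formula,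
    which gives its value on the Seifert rational homology sphere X (E != 0). *)
Definition casson_walker : R :=
  (3 * Num.sg E - E - \sum_j S j
   - E^-1 * (2 - n%:R + \sum_j (alpha j ^+ 2)^-1)) / 12.

Definition tau0_fun (z : R) : R :=
  pi_csc z ^+ (n - 2) * \prod_j sin (pi * z / alpha j).

(** k_1 = - floor((n - 2) / 2) *)
Definition tau0_k1 : int := - ((n - 2) %/ 2)%N%:Z.

(** c_k, meaningful for k >= k_1, where the integer 2k + n - 2 is nonnegative.
    The derivative at z = 0 is taken along the real axis, where tau0_fun is real. *)
Definition tau0_coef (k : int) : R[i] :=
  let m := `|(k *+ 2 + n%:Z - 2)%R|%N in
  ((pi ^+ (n - 2))^-1)%:C
  * (cis (pi / 4 * Num.sg E) / (Num.sqrt (2 * pi * `|E|))%:C)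
  * (Gamma (k%:~R + 2^-1) / m`!%:R)%:C
  * (2 * 'i%C / (pi * E)%:C) ^ k
  * (derive1n m tau0_fun 0)%:C.

(** The contribution of the trivial connection to the large r expansion of the
    SU(2) Reshetikhin-Turaev invariant tau_r(X), as a formal expansion. *)
Definition tau0 : fexp R[i] :=
  fexp_mono ((2 / Num.sqrt seifert_A)%:C * cis (- (3 * pi / 4) * Num.sg E)) 1
  ** fexp_exp ('i%C * (pi / 2 * (3 * Num.sg E - E - \sum_j S j))%:C)
  ** fexp_rinv tau0_k1 (fun j => tau0_coef (tau0_k1 + j%:Z)).

End Seifert.

(* Main.v *)
Require Import Defs.
From mathcomp Require Import all_boot all_order all_algebra.
From mathcomp Require Import all_classical all_reals all_analysis.
From mathcomp Require Import complex.
From mathcomp Require Import measurable_realfun zify ring lra.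
Import Order.TTheory GRing.Theory Num.Theory.
Import numFieldNormedType.Exports.
Local Open Scope complex_scope.
Local Open Scope ring_scope.

(** The factor [z^n] of [tau0_fun] kills every [c_k] with [k < 1], so the series
    starts at [r^(-3/2)], and only [c_1] and [c_2] matter for the first two
    coefficients.  They are read off
      [tau0_fun z = pi^n / A * z^n * (1 + q z^2 + O(z^3))],
      [q = - pi^2 / 6 * (2 - n + \sum_j 1 / alpha_j^2)],
    and from [Gamma (3/2)] and [Gamma (5/2)]: one finds that [c_2 / c_1] is
    [3 i q / (pi E)], and adding the coefficient of [1/r] in the exponential
    prefactor gives [6 pi i] times Lescop's expression. *)

Section Jets.
Set Implicit Arguments.
Unset Strict Implicit.
Context {R : realType}.
Implicit Types (f g : R -> R) (p q : {poly R}).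

(** [f] is [N] times differentiable near [0], with Taylor polynomial [p] at [0]
    up to [z^N]; higher coefficients of [p] are irrelevant. *)
Fixpoint jet (N : nat) f p : Prop :=
  f 0 = p`_0 /\
  if N is N'.+1 then
    exists2 g, (\forall x \near (0 : R), is_derive x (1 : R) f (g x)) &
               jet N' g p^`()
  else True.

Lemma jet0 N f p : jet N f p -> f 0 = p`_0.
Proof. by case: N => [|N] []. Qed.

Lemma jetW N f p : jet N.+1 f p -> jet N f p.
Proof.
elim: N f p => [|N IHN] f p [f0 [g dfg gp]]; split => //.
by exists g => //; exact: IHN.
Qed.

Lemma jet_near N f g p :
  (\forall x \near (0 : R), f x = g x) -> jet N f p -> jet N g p.
Proof.
move=> fg; have fg0 : f 0 = g 0 by exact: nbhs_singleton fg.
case: N => [|N] [f0 /= h]; split; rewrite -?fg0 //.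
case: h => h dfh hp; exists h => //.
have fg2 : \forall x \near (0 : R), \forall y \near x, f y = g y.
  exact: near_join.
by apply: (filterS2 _ _ dfh fg2) => x dfx fgx; exact: near_eq_is_derive fgx dfx.
Qed.

Lemma jet_eq_coef N f p q :
  (forall i, (i <= N)%N -> p`_i = q`_i) -> jet N f p -> jet N f q.
Proof.
elim: N f p q => [|N IHN] f p q pq [f0 h]; split; rewrite -?pq //.
case: h => g dfg gp; exists g => //.
by apply: IHN gp => i iN; rewrite !coef_deriv pq.
Qed.

Lemma jet_cst N (c : R) : jet N (fun=> c) c%:P.
Proof.
elim: N c => [|N IHN] c; (split; first by rewrite coefC) => //.
exists (fun=> 0); first by near=> x; exact: is_derive_cst.
by rewrite derivC -(polyC0 R); exact: IHN.
Unshelve. all: by end_near. Qed.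

Lemma jet_id N : jet N id 'X.
Proof.
case: N => [|N]; (split; first by rewrite coefX) => //.
exists (fun=> 1); first by near=> x; exact: is_derive_id.
by rewrite derivX -polyC1; exact: jet_cst.
Unshelve. all: by end_near. Qed.

Lemma jetD N f g p q :
  jet N f p -> jet N g q -> jet N (fun x => f x + g x) (p + q).
Proof.
elim: N f g p q => [|N IHN] f g p q [f0 hf] [g0 hg];
  (split; first by rewrite coefD f0 g0) => //.
case: hf => f' df jf; case: hg => g' dg jg.
exists (fun x => f' x + g' x); last by rewrite derivD; exact: IHN.
by near=> x; apply: is_deriveD; near: x.
Unshelve. all: by end_near. Qed.

Lemma jetM N f g p q :
  jet N f p -> jet N g q -> jet N (fun x => f x * g x) (p * q).
Proof.
elim: N f g p q => [|N IHN] f g p q jf jg;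
  (split; first by rewrite (jet0 jf) (jet0 jg) coefM big_ord1 subnn) => //.
have [_ [f' df jf']] := jf; have [_ [g' dg jg']] := jg.
exists (fun x => f' x * g x + f x * g' x).
  near=> x; have dfx : is_derive x (1 : R) f (f' x) by near: x.
  have dgx : is_derive x (1 : R) g (g' x) by near: x.
  apply: is_derive_eq (@is_deriveM _ _ f g x 1 _ _ dfx dgx) _.
  by rewrite /GRing.scale /= addrC [g x * _]mulrC.
by rewrite derivM; apply: jetD; apply: IHN => //; exact: jetW.
Unshelve. all: by end_near. Qed.

Lemma jet_exp N f p n : jet N f p -> jet N (fun x => f x ^+ n) (p ^+ n).
Proof.
move=> jf; elim: n => [|n IHn]; first exact: jet_cst.
rewrite exprS; apply: jet_near (jetM jf IHn).
by near=> x; rewrite exprS.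
Unshelve. all: by end_near. Qed.

Lemma jet_derive1n N f p k :
  jet N f p -> (k <= N)%N -> derive1n k f 0 = p`_k *+ k`!.
Proof.
elim: k N f p => [|k IHk] N f p; first by move=> /jet0.
case: N => // N [f0 [g dfg jg]] kN.
have jf' : jet N f^`()%classic p^`().
  apply: jet_near jg; near=> x; rewrite derive1E.
  have dfx : is_derive x (1 : R) f (g x) by near: x.
  by rewrite derive_val.
by rewrite derive1Sn (IHk _ _ _ jf') // coef_deriv factS mulrnA.
Unshelve. all: by end_near. Qed.

Lemma jet_unique N f p q k :
  jet N f p -> jet N f q -> (k <= N)%N -> p`_k = q`_k.
Proof.
move=> jp jq kN; have := jet_derive1n jp kN; rewrite (jet_derive1n jq kN).
by move/eqP; rewrite -subr_eq0 -mulrnBl mulrn_eq0 gtn_eqF ?fact_gt0 //=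
  subr_eq0 => /eqP.
Qed.

Lemma jetV N f p : f 0 != 0 -> jet N f p ->
  exists q, jet N (fun x => (f x)^-1) q.
Proof.
move=> f0; elim: N => [|N IHN] jf.
  by exists ((f 0)^-1)%:P; rewrite /= coefC.
have [q jq] := IHN (jetW jf); have [_ [f' df jf']] := jf.
(* The jet of [1/f] is the antiderivative of the jet [s] of [- f' / f^2]. *)
have js := jetM (jetM (jet_cst N (-1)) jf') (jet_exp 2 jq).
set s := (_ * _) in js.
exists (\poly_(i < (size s).+1) if i is j.+1 then s`_j / j.+1%:R else (f 0)^-1).
split; first by rewrite coef_poly.
exists (fun x => -1 * f' x * (f x)^-1 ^+ 2).
  have cf : {for (0 : R), continuous f}.
    have d0 : is_derive (0 : R) (1 : R) f (f' 0) by exact: nbhs_singleton df.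
    by apply: differentiable_continuous; apply/derivable1_diffP.
  have fn0 : \forall x \near (0 : R), f x != 0.
    exact: (cvgr_neq0 _ cf f0).
  near=> x.
  have dfx : is_derive x (1 : R) f (f' x) by near: x.
  have fx : f x != 0 by near: x.
  apply: is_derive_eq (is_deriveV fx dfx) _.
  by rewrite /GRing.scale /= exprVn mulN1r !mulNr mulrC.
apply: jet_eq_coef js => i iN; rewrite coef_deriv coef_poly ltnS.
case: ltnP => [_|si]; last by rewrite mul0rn nth_default.
by rewrite -[RHS]mulr_natr divfK // pnatr_eq0.
Unshelve. all: by end_near. Qed.

End Jets.

Section ExponentialTypeSeries.
Set Implicit Arguments.
Unset Strict Implicit.
Context {R : realType}.
Implicit Types (a : nat -> R) (C M : R).

Lemma is_cvg_pseries_exp_type a C M x :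
  (forall n, `|a n| <= C * (M ^+ n / n`!%:R)) -> cvgn (pseries a x).
Proof.
move=> aCM; have C0 : 0 <= C.
  by have := aCM 0%N; rewrite divr1 mulr1; exact: le_trans.
apply: normed_cvg.
apply: series_le_cvg; last first.
- exact: (is_cvg_seriesZ (k := C) (is_cvg_series_exp_coeff (`|M| * `|x|))).
- move=> n; have -> : (C *: exp_coeff (`|M| * `|x|)) n =
      C * ((`|M| * `|x|) ^+ n / n`!%:R) by [].
  rewrite /= normrM normrX exprMn.
  rewrite [_ ^+ n * _ / _]mulrAC mulrA ler_wpM2r ?exprn_ge0//.
  rewrite (le_trans (aCM n))//.
  by rewrite ler_wpM2l// ler_wpM2r ?invr_ge0// -normrX ler_norm.
- by move=> n; rewrite mulr_ge0// divr_ge0// exprn_ge0// mulr_ge0.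
- by move=> n; rewrite normr_ge0.
Qed.

Lemma pseries_diffs_exp_type a C M :
  (forall n, `|a n| <= C * (M ^+ n / n`!%:R)) ->
  forall n, `|pseries_diffs a n| <= C * M * (M ^+ n / n`!%:R).
Proof.
move=> aCM n; rewrite /pseries_diffs normrM normr_nat.
apply: le_trans (ler_wpM2l _ (aCM n.+1)) _ => //.
rewrite le_eqVlt; apply/orP; left; apply/eqP.
have n0 : n`!%:R != 0 :> R by rewrite pnatr_eq0 -lt0n fact_gt0.
rewrite factS natrM exprS; field.
by rewrite n0 ?natr1 ?nat1r pnatr_eq0.
Qed.

Lemma pseries0 a : limn (pseries a 0) = a 0%N.
Proof.
apply/cvg_lim => //; rewrite -cvg_shiftS; apply: cvg_near_cst; near=> n.
rewrite /pseries /series /= big_nat_recl //= expr0 mulr1 big1 ?addr0// => i _.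
by rewrite exprS mul0r mulr0.
Unshelve. all: by end_near. Qed.

Lemma jet_pseries N a C M :
  (forall n, `|a n| <= C * (M ^+ n / n`!%:R)) ->
  jet N (fun x => limn (pseries a x)) (\poly_(i < N.+1) a i).
Proof.
elim: N a C => [|N IHN] a C aCM;
  (split; first by rewrite coef_poly pseries0) => //.
have a1 := pseries_diffs_exp_type aCM; have a2 := pseries_diffs_exp_type a1.
exists (fun x => limn (pseries (pseries_diffs a) x)).
  near=> x; apply: (@pseries_snd_diffs _ a (`|x| + 1)).
  - exact: is_cvg_pseries_exp_type aCM.
  - exact: is_cvg_pseries_exp_type a1.
  - exact: is_cvg_pseries_exp_type a2.
  - by rewrite [ltRHS]ger0_norm ?addr_ge0// ltrDl.
apply: jet_eq_coef (IHN _ _ a1) => i iN.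
by rewrite coef_deriv !coef_poly !ltnS iN /pseries_diffs mulr_natl.
Unshelve. all: by end_near. Qed.

End ExponentialTypeSeries.

Section EvenJets.
Set Implicit Arguments.
Unset Strict Implicit.
Context {R : realType}.
Implicit Types (f g : R -> R) (c d t : R).

(** [f] is smooth near [0] with [f z = 1 + c z^2 + O(z^3)]. *)
Definition even_jet f c := forall N, exists2 p : {poly R}, jet N f p &
  [/\ p`_0 = 1, p`_1 = 0 & p`_2 = c].

Lemma even_jet1 : even_jet (fun=> 1) 0.
Proof. by move=> N; exists 1%:P; [exact: jet_cst|rewrite !coefC]. Qed.

Lemma even_jetM f g c d : even_jet f c -> even_jet g d ->
  even_jet (fun z => f z * g z) (c + d).
Proof.
move=> hf hg N; have [p jp [p0 p1 p2]] := hf N; have [q jq [q0 q1 q2]] := hg N.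
exists (p * q); first exact: jetM.
rewrite !coefM !big_ord_recl !big_ord0 /= /bump /= !addn0 !subn0 /=.
by rewrite ?(subnn, p0, p1, p2, q0, q1, q2) /=; split; ring.
Qed.

Lemma even_jet_prod n (f : 'I_n -> R -> R) (c : 'I_n -> R) :
  (forall i, even_jet (f i) (c i)) ->
  even_jet (fun z => \prod_i f i z) (\sum_i c i).
Proof.
elim: n f c => [|n IHn] f c hf.
  rewrite big_ord0 (_ : (fun _ => _) = fun=> 1); first exact: even_jet1.
  by apply/funext => z; rewrite big_ord0.
rewrite big_ord_recl (_ : (fun _ => _) = fun z => f ord0 z *
  \prod_i f (lift ord0 i) z); first by apply: even_jetM => //; exact: IHn.
by apply/funext => z; rewrite big_ord_recl.
Qed.

Lemma even_jet_exp f c n :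
  even_jet f c -> even_jet (fun z => f z ^+ n) (c *+ n).
Proof.
move=> hf; have := @even_jet_prod n (fun=> f) (fun=> c) (fun=> hf).
rewrite sumr_const card_ord (_ : (fun _ => _) = fun z => f z ^+ n) //.
by apply/funext => z; rewrite prodr_const card_ord.
Qed.

Lemma even_jetV f c : even_jet f c -> even_jet (fun z => (f z)^-1) (- c).
Proof.
move=> hf N; have [p jp [p0 p1 p2]] := hf N.+2.
have f0 : f 0 = 1 by rewrite (jet0 jp).
have f0n : f 0 != 0 by rewrite f0 oner_neq0.
have [q jq] := jetV f0n jp.
have j1 : jet N.+2 (fun=> 1) (p * q).
  apply: jet_near (jetM jp jq).
  have [_ [f' df _]] := jp.
  have d0 : is_derive (0 : R) (1 : R) f (f' 0) by exact: nbhs_singleton df.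
  have cf : {for (0 : R), continuous f}.
    by apply: differentiable_continuous; apply/derivable1_diffP.
  near=> z; rewrite mulfV//; near: z.
  exact: (cvgr_neq0 _ cf f0n).
have e k : (k <= N.+2)%N -> (p * q)`_k = (k == 0%N)%:R.
  move=> kN; rewrite (jet_unique j1 (jet_cst _ 1) kN) coefC.
  by case: (k == 0%N).
have e0 := e 0%N isT; have e1 := e 1%N isT; have e2 := e 2 isT.
exists q; first by do 2 apply: jetW.
move: e0 e1 e2.
rewrite !coefM !big_ord_recl !big_ord0 /= /bump /= !addn0 !subn0 /=.
rewrite ?(subnn, p0, p1, p2) /= !addr0 !mul0r !addr0 !mul1r add0r => q0 q1.
by rewrite q0 q1 => h; split => //; lra.
Unshelve. all: by end_near. Qed.

Definition sinc_coeff t n : R :=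
  (~~ odd n)%:R * (-1) ^+ n./2 * t ^+ n / n.+1`!%:R.

Lemma sinc_coeff_le t n : `|sinc_coeff t n| <= 1 * (`|t| ^+ n / n`!%:R).
Proof.
rewrite /sinc_coeff !normrM normfV normr_nat normrX normrN normr1 expr1n mulr1.
rewrite normrX mul1r normr_nat ler_pM ?mulr_ge0 ?exprn_ge0 ?invr_ge0//.
  by rewrite ler_piMl ?exprn_ge0//; case: odd.
rewrite lef_pV2 ?posrE ?ltr0n ?fact_gt0// ler_nat factS leq_pmull//.
Qed.

Definition sinc t z := limn (pseries (sinc_coeff t) z).

Lemma even_jet_sinc t : even_jet (sinc t) (- (t ^+ 2 / 6)).
Proof.
move=> N; exists (\poly_(i < N.+3) sinc_coeff t i).
  by do 2 apply: jetW; apply: jet_pseries (sinc_coeff_le t).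
rewrite !coef_poly /= /sinc_coeff /=; split.
- by rewrite !expr0 !mulr1 divr1.
- by rewrite !mul0r.
- by rewrite (_ : 3`! = 6%N)//; field.
Qed.

Lemma sinc0 t : sinc t 0 = 1.
Proof. by have [p /jet0 -> []] := even_jet_sinc t 0. Qed.

Lemma sin_sinc t z : sin (t * z) = t * z * sinc t z.
Proof.
rewrite unlock; apply/cvg_lim => //; rewrite -cvg_shiftS.
rewrite (_ : [sequence _]_n = (fun n => t * z * pseries (sinc_coeff t) z n)).
  by apply: cvgMr; exact: is_cvg_pseries_exp_type (sinc_coeff_le t).
apply/funext => n; rewrite /pseries /series /= big_nat_recl //=.
rewrite [X in X + _](_ : _ = 0) ?add0r; last by rewrite /sin_coeff /= !mul0r.
rewrite mulr_sumr; apply: eq_bigr => i _; rewrite /sin_coeff /sinc_coeff /=.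
by rewrite exprS exprMn; ring.
Qed.

Lemma pi_csc_sinc z : pi_csc z = (sinc pi z)^-1.
Proof.
rewrite /pi_csc; have [->|z0] := eqVneq z 0; first by rewrite sinc0 invr1.
by rewrite sin_sinc invfM mulrA divff ?mul1r// mulf_neq0 // gt_eqF ?pi_gt0.
Qed.

End EvenJets.

Section GammaHalfIntegers.
Set Implicit Arguments.
Unset Strict Implicit.
Context {R : realType}.
Local Notation mu := (@lebesgue_measure R).
Local Notation Phi := (@gauss_integral_proof.integral0_gauss R).
Import gauss_integral_proof.
Local Open Scope classical_set_scope.
Implicit Types x t : R.

Let integrable_gauss x : mu.-integrable `[0, x] (EFin \o gauss_fun).
Proof.
apply: continuous_compact_integrable => //; first exact: segment_compact.
by apply: continuous_subspaceT; exact: continuous_gauss_fun.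
Qed.

Lemma is_derive_integral0_gauss x :
  0 < x -> is_derive x (1 : R) Phi (gauss_fun x).
Proof.
move=> x0.
have [dP <-] : derivable Phi x 1 /\ Phi^`() x = gauss_fun x.
  apply: (@continuous_FTC1 R gauss_fun (BLeft 0) _ (x + 1)).
  - by rewrite ltrDl.
  - exact: integrable_gauss.
  - by rewrite /= lte_fin.
  - by move=> ?; exact: continuous_gauss_fun.
by rewrite derive1E; exact: derivableP.
Qed.

Lemma cvg_integral0_gauss0 : Phi x @[x --> 0^'+] --> Phi 0.
Proof.
have /(continuous_within_itvP _ ltr01)[_ + _] :=
  parameterized_integral_continuous ler01 (integrable_gauss 1).
exact.
Qed.

Lemma cvg_integral0_gauss_pinfty : Phi x @[x --> +oo] --> Num.sqrt pi / 2.
Proof.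
have : Num.sqrt (Phi x ^+ 2) @[x --> +oo] --> Num.sqrt (pi / 4).
  apply: continuous_cvg => //;
    [exact: sqrt_continuous|exact: cvg_integral0_gauss_sqr].
rewrite sqrtrM ?pi_ge0// sqrtrV// (_ : 4 = 2 ^+ 2); last first.
  by rewrite expr2 -natrM.
rewrite sqrtr_sqr ger0_norm//.
rewrite (_ : (fun _ => Num.sqrt _) = Phi)//.
apply/funext => r; rewrite sqrtr_sqr// ger0_norm//.
exact: integral0_gauss_ge0.
Qed.

Lemma cvg_exprM_expRN k :
  t ^+ k * expR (- t) @[t --> (+oo : set_system R)] --> (0 : R).
Proof.
apply/cvgrPdist_le => e e0; near=> t.
have t0 : 0 < t by near: t; exact: nbhs_pinfty_gt.
rewrite sub0r normrN ger0_norm ?mulr_ge0 ?exprn_ge0 ?expR_ge0 ?(ltW t0)//.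
rewrite expRN ler_pdivrMr ?expR_gt0//.
have f0 : 0 < (k.+1`!%:R : R) by rewrite ltr0n fact_gt0.
apply: (@le_trans _ _ (e * (t ^+ k.+1 / k.+1`!%:R))); last first.
  rewrite ler_pM2l// (le_trans _ (expR_ge1Dxn k (ltW t0)))//.
  by rewrite lerDr ler01.
have -> : e * (t ^+ k.+1 / k.+1`!%:R) = e * t / k.+1`!%:R * t ^+ k.
  by rewrite exprS; ring.
rewrite ler_peMl ?exprn_ge0 ?(ltW t0)// ler_pdivlMr// mul1r mulrC
   -ler_pdivrMr//.
Unshelve. all: by end_near. Qed.

Lemma sqrtr_cvg0 : Num.sqrt x @[x --> (0 : R)^'+] --> Num.sqrt (0 : R).
Proof.
by apply: cvg_at_right_filter; exact: sqrt_continuous.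
Qed.

(** Primitives of [t^(1/2) e^(-t)] and [t^(3/2) e^(-t)], reached from the Gauss
    integral by substituting [x = sqrt t] and integrating by parts. *)
Definition gamma32_primitive t := Phi (Num.sqrt t) - Num.sqrt t * expR (- t).
Definition gamma52_primitive t :=
  3 / 2 * gamma32_primitive t - t * Num.sqrt t * expR (- t).

Lemma is_derive_gamma32_primitive t : 0 < t ->
  is_derive t (1 : R) gamma32_primitive (Num.sqrt t * expR (- t)).
Proof.
move=> t0; have s0 : 0 < Num.sqrt t by rewrite sqrtr_gt0.
have dP := is_derive_integral0_gauss s0.
have dE : is_derive t (1 : R) (fun t => expR (- t)) (- expR (- t)).
  by apply: is_derive_eq; rewrite /GRing.scale /= mulrN1.
have dS := is_derive1_sqrt t0.
have := is_deriveB (is_derive1_comp dP dS) (is_deriveM dS dE).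
move=> h; apply: (is_derive_eq h).
rewrite /gauss_fun sqr_sqrtr ?(ltW t0)// /GRing.scale /=.
field; by rewrite gt_eqF.
Qed.

Lemma is_derive_gamma52_primitive t : 0 < t ->
  is_derive t (1 : R) gamma52_primitive (t * Num.sqrt t * expR (- t)).
Proof.
move=> t0; have s0 : 0 < Num.sqrt t by rewrite sqrtr_gt0.
have dE : is_derive t (1 : R) (fun t => expR (- t)) (- expR (- t)).
  by apply: is_derive_eq; rewrite /GRing.scale /= mulrN1.
have dS := is_derive1_sqrt t0.
have := is_deriveB (is_deriveZ (3 / 2) (is_derive_gamma32_primitive t0))
  (is_deriveM (is_deriveM (is_derive_id t 1) dS) dE).
move=> h; apply: (is_derive_eq h).
rewrite /GRing.scale /=.
rewrite [(id * _)%R t](_ : _ = t * Num.sqrt t)//.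
have := sqr_sqrtr (ltW t0).
move: (Num.sqrt t) (expR (- t)) s0 => s e s0 {h dS dE t0} <-.
field; by rewrite gt_eqF.
Qed.

Lemma cvg_sqrt_expRN :
  Num.sqrt t * expR (- t) @[t --> (+oo : set_system R)] --> (0 : R).
Proof.
apply: (@squeeze_cvgr _ _ _ _ (fun=> 0) (fun t => t ^+ 1 * expR (- t))).
- near=> t; have t1 : 1 <= t by near: t; apply: nbhs_pinfty_ge; exact: num_real.
  rewrite mulr_ge0 ?sqrtr_ge0 ?expR_ge0//= ler_wpM2r ?expR_ge0//.
  rewrite -(@ler_pXn2r _ 2) ?nnegrE ?sqrtr_ge0 ?exprn_ge0 ?(le_trans ler01)//.
  rewrite sqr_sqrtr ?(le_trans ler01)// expr1 expr2.
  by rewrite ler_peMl ?(le_trans ler01).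
- exact: cvg_cst.
- exact: cvg_exprM_expRN.
Unshelve. all: by end_near. Qed.

Lemma cvg_M_sqrt_expRN :
  t * Num.sqrt t * expR (- t) @[t --> (+oo : set_system R)] --> (0 : R).
Proof.
apply: (@squeeze_cvgr _ _ _ _ (fun=> 0) (fun t => t ^+ 2 * expR (- t))).
- near=> t; have t1 : 1 <= t by near: t; apply: nbhs_pinfty_ge; exact: num_real.
  have t0 : 0 <= t by apply: le_trans t1.
  rewrite !mulr_ge0 ?sqrtr_ge0 ?expR_ge0//= ler_wpM2r ?expR_ge0//.
  rewrite expr2 ler_wpM2l// -(@ler_pXn2r _ 2) ?nnegrE ?sqrtr_ge0//.
  by rewrite sqr_sqrtr// expr2 ler_peMl.
- exact: cvg_cst.
- exact: cvg_exprM_expRN.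
Unshelve. all: by end_near. Qed.

Lemma continuous_expRN : continuous (fun t : R => expR (- t)).
Proof.
move=> t; apply: continuous_comp; first exact: opp_continuous.
exact: continuous_expR.
Qed.

Lemma cvg_gamma32_primitive_pinfty :
  gamma32_primitive t @[t --> +oo] --> Num.sqrt pi / 2.
Proof.
rewrite -[X in _ --> X]subr0; apply: cvgB; last exact: cvg_sqrt_expRN.
apply: cvg_comp cvg_integral0_gauss_pinfty.
apply/cvgryPge => M; near=> t.
have t0 : M ^+ 2 <= t by near: t; apply: nbhs_pinfty_ge; exact: num_real.
by rewrite (le_trans (ler_norm M))// -sqrtr_sqr ler_wsqrtr.
Unshelve. all: by end_near. Qed.

Lemma cvg_gamma32_primitive0 :
  gamma32_primitive t @[t --> 0^'+] --> gamma32_primitive 0.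
Proof.
apply: cvgB; last first.
  apply: cvgM; first exact: sqrtr_cvg0.
  exact/cvg_at_right_filter/continuous_expRN.
rewrite sqrtr0; apply: cvg_comp cvg_integral0_gauss0.
have : Num.sqrt x @[x --> (0:R)^'+] --> (0 : R).
  by rewrite -[X in _ --> X]sqrtr0; exact: sqrtr_cvg0.
move=> hs A hA; have {}hs := hs _ hA.
have h0 : \forall t \near (0 : R)^'+, 0 < t by exact: nbhs_right_gt.
by apply: (filterS2 _ _ h0 hs) => t t0; apply; rewrite sqrtr_gt0.
Qed.

Lemma gamma32_primitive_at0 : gamma32_primitive 0 = 0.
Proof.
by rewrite /gamma32_primitive sqrtr0 mul0r subr0 /integral0_gauss set_itv1
  Rintegral_set1.
Qed.

Lemma gamma_integral_primitive (x l : R) (f F : R -> R) :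
  (forall t, 0 < t -> t `^ (x - 1) * expR (- t) = f t) ->
  (forall t, 0 <= t -> 0 <= f t) -> continuous f ->
  F t @[t --> +oo] --> l -> (forall t, 0 < t -> is_derive t (1 : R) F (f t)) ->
  F t @[t --> 0^'+] --> F 0 -> gamma_integral x = l - F 0.
Proof.
move=> xf f0 cf Fl dF F0.
have -> : gamma_integral x = Rintegral mu `]0, +oo[ f.
  by apply: eq_Rintegral => t; rewrite inE /= in_itv/= andbT => /xf.
rewrite /Rintegral integral_itv_obnd_cbnd; last first.
  by apply/measurable_EFinP/measurable_funTS; exact: continuous_measurable_fun.
rewrite (ge0_continuous_FTC2y f0 _ Fl _ F0) //.
- by apply: continuous_subspaceT.
- by move=> t /dF[].
- by move=> t; rewrite in_itv/= andbT derive1E => /dF[].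
Qed.

Lemma Gamma_3_2 : Gamma (3 / 2) = Num.sqrt pi / 2 :> R.
Proof.
rewrite /Gamma ifT ?divr_gt0//.
rewrite (gamma_integral_primitive (f := fun t => Num.sqrt t * expR (- t))
  _ _ _ cvg_gamma32_primitive_pinfty is_derive_gamma32_primitive
  cvg_gamma32_primitive0).
- by rewrite gamma32_primitive_at0 subr0.
- move=> t /ltW t0.
  by rewrite (_ : 3 / 2 - 1 = 2^-1) ?powR12_sqrt//; field.
- by move=> t _; rewrite mulr_ge0 ?sqrtr_ge0 ?expR_ge0.
- move=> t; apply: continuousM; first exact: sqrt_continuous.
  exact: continuous_expRN.
Qed.

Lemma Gamma_5_2 : Gamma (5 / 2) = 3 / 4 * Num.sqrt pi :> R.
Proof.
rewrite /Gamma ifT ?divr_gt0//.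
have -> : gamma_integral (5 / 2) =
    3 / 2 * (Num.sqrt pi / 2) - 0 - gamma52_primitive 0 :> R.
  apply: (@gamma_integral_primitive _ _ (fun t => t * Num.sqrt t * expR (- t))).
  - move=> t t0; rewrite (_ : 5 / 2 - 1 = 1 + 2^-1); last by field.
    rewrite powRD ?powRr1 ?powR12_sqrt ?(ltW t0)//.
    by rewrite (gt_eqF t0) implybT.
  - by move=> t t0; rewrite !mulr_ge0 ?sqrtr_ge0 ?expR_ge0.
  - move=> t; apply: cvgM; last exact: continuous_expRN.
    by apply: cvgM; [exact: cvg_id|exact: sqrt_continuous].
  - apply: cvgB cvg_M_sqrt_expRN; apply: cvgMr.
    exact: cvg_gamma32_primitive_pinfty.
  - exact: is_derive_gamma52_primitive.
  - apply: cvgB; first by apply: cvgMr; exact: cvg_gamma32_primitive0.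
    apply: cvgM; last exact/cvg_at_right_filter/continuous_expRN.
    by apply: cvgM; [exact: cvg_at_right_filter cvg_id|exact: sqrtr_cvg0].
by rewrite /gamma52_primitive gamma32_primitive_at0; field.
Qed.

End GammaHalfIntegers.

Section TrivialConnection.
Set Implicit Arguments.
Unset Strict Implicit.
Context {R : realType}.
Variable X : seifert.
Local Notation n := (sf_n X).
Local Notation alpha j := ((@sf_alpha X j)%:R : R).

Lemma alpha_gt0 j : 0 < alpha j.
Proof.
rewrite ltr0n; have /andP[b0] := sf_normalized j; exact: leq_trans.
Qed.

Lemma seifert_A_gt0 : 0 < seifert_A R X.
Proof. by apply: prodr_gt0 => j _; exact: alpha_gt0. Qed.

(** The ratio of the coefficients of [z^(n+2)] and [z^n] in [tau0_fun]. *)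
Definition tau0_quad : R :=
  - (pi ^+ 2 / 6 * (2 - n%:R + \sum_j (alpha j ^+ 2)^-1)).

Lemma tau0_fun_factor (z : R) : tau0_fun X z =
  pi ^+ n / seifert_A R X * (z ^+ n *
    ((sinc pi z)^-1 ^+ (n - 2) * \prod_j sinc (pi / alpha j) z)).
Proof.
rewrite /tau0_fun pi_csc_sinc.
have -> : \prod_j sin (pi * z / alpha j) =
    pi ^+ n / seifert_A R X * z ^+ n * \prod_j sinc (pi / alpha j) z.
  under eq_bigr => j _ do rewrite mulrAC sin_sinc.
  by rewrite !big_split /= !prodr_const card_ord prodfV.
ring.
Qed.

Lemma derive1n_tau0_fun :
  [/\ forall k, (k < n)%N -> derive1n k (tau0_fun X) (0 : R) = 0,
      derive1n n (tau0_fun X) (0 : R) = pi ^+ n / seifert_A R X *+ n`! &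
      (2 <= n)%N -> derive1n n.+2 (tau0_fun X) (0 : R) =
        pi ^+ n / seifert_A R X * tau0_quad *+ n.+2`!].
Proof.
have := even_jetM
  (even_jet_exp (n - 2) (even_jetV (even_jet_sinc (pi : R))))
  (@even_jet_prod _ n _ _ (fun j => even_jet_sinc (pi / alpha j))).
move=> /(_ n.+2)[q jq [q0 q1 q2]].
have jF : jet n.+2 (tau0_fun X)
    ((pi ^+ n / seifert_A R X)%:P * ('X^n * q)).
  apply: jet_near (jetM (jet_cst _ _) (jetM (jet_exp n (jet_id _)) jq)).
  by near=> z; rewrite tau0_fun_factor.
split.
- move=> k kn; rewrite (jet_derive1n jF) ?coefCM ?coefXnM ?kn ?mulr0 ?mul0rn//.
  by rewrite ltnW// ltnW// ltnW.
- rewrite (jet_derive1n jF) ?coefCM ?coefXnM ?ltnn ?subnn ?q0 ?mulr1//.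
  by rewrite ltnW.
- move=> n2; rewrite (jet_derive1n jF) // coefCM coefXnM ltnNge ltnW//=.
  rewrite -addn2 addKn q2; congr (_ * _ *+ _).
  rewrite opprK /tau0_quad sumrN -[_ / 6 *+ _]mulr_natr natrB//.
  under eq_bigr => j _ do
    rewrite exprMn exprVn -mulrA mulrCA [pi ^+ 2 * _]mulrC.
  rewrite -mulr_suml; ring.
Unshelve. all: by end_near. Qed.

Local Notation E := (seifert_euler R X).
Local Notation A := (seifert_A R X).
Local Notation K := ((n - 2) %/ 2)%N.

Lemma tau0_coefE (k : int) (m : nat) (y : R) :
  k *+ 2 + n%:Z - 2 = m%:Z -> derive1n m (tau0_fun X) 0 = y *+ m`! ->
  tau0_coef R X k =
    ((pi ^+ (n - 2))^-1)%:C
    * (cis (pi / 4 * Num.sg E) / (Num.sqrt (2 * pi * `|E|))%:C)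
    * (Gamma (k%:~R + 2^-1) * y)%:C * (2 * 'i%C / (pi * E)%:C) ^ k.
Proof.
move=> km ym; rewrite /tau0_coef km absz_nat ym.
have -> : Gamma (k%:~R + 2^-1) * y =
    Gamma (k%:~R + 2^-1) / m`!%:R * (y *+ m`!) :> R.
  by rewrite -mulr_natr; field; rewrite pnatr_eq0 -lt0n fact_gt0.
by rewrite [in RHS]rmorphM; ring.
Qed.

Lemma tau0_coef_eq0 j : (2 <= n)%N -> (j <= K)%N ->
  tau0_coef R X (tau0_k1 X + j%:Z) = 0.
Proof.
move=> n2 jK; have [h _ _] := derive1n_tau0_fun.
have Kn : (K * 2 <= n - 2)%N by exact: leq_divM.
rewrite (@tau0_coefE _ ((n - 2) - (K - j) * 2)%N 0); first last.
- by rewrite mul0rn h//; lia.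
- by rewrite /tau0_k1; lia.
- by rewrite mulr0 mulr0 mul0r.
Qed.

Lemma tau0_coef1 :
  tau0_coef R X 1 = ((pi ^+ (n - 2))^-1)%:C
    * (cis (pi / 4 * Num.sg E) / (Num.sqrt (2 * pi * `|E|))%:C)
    * (Num.sqrt pi / 2 * (pi ^+ n / A))%:C * (2 * 'i%C / (pi * E)%:C).
Proof.
have [_ h _] := derive1n_tau0_fun.
rewrite (tau0_coefE _ h) ?expr1z; last by lia.
by rewrite (_ : 1%:~R + 2^-1 = 3 / 2) ?Gamma_3_2//; field.
Qed.

Let i2divC (x : R) : 2 * 'i%C / x%:C = 'i%C * (2 / x)%:C.
Proof. by rewrite rmorphM /= fmorphV rmorph_nat; ring. Qed.

Lemma tau0_coef2 : (2 <= n)%N -> E != 0 ->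
  tau0_coef R X 2 = tau0_coef R X 1 * ('i%C * (3 * tau0_quad / (pi * E))%:C).
Proof.
move=> n2 E0; have [_ _ h] := derive1n_tau0_fun.
rewrite (tau0_coefE _ (h n2)); last by lia.
rewrite tau0_coef1 (_ : 2%:~R + 2^-1 = 5 / 2) ?Gamma_5_2; last by field.
rewrite -exprnP expr2 i2divC.
set x := (3 / 4 * _ * _); set y := (_ / 2 * _).
set w := 2 / _; set v := 3 * _ / _.
set P := _ * (cis _ / _).
have e : x * w * w = y * w * v.
  rewrite /x /y /w /v.
  have A0 : A != 0 by rewrite gt_eqF ?seifert_A_gt0.
  have : (pi : R) != 0 by rewrite gt_eqF ?pi_gt0.
  move: (pi : R) => p p0; field.
  by rewrite E0 p0.
transitivity (P * 'i%C * 'i%C * (x * w * w)%:C).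
  by rewrite !rmorphM /=; ring.
by rewrite e !rmorphM /=; ring.
Qed.

Lemma cisD (a b : R) : cis (a + b) = cis a * cis b.
Proof. by rewrite /cis cosD sinD; simpc; rewrite [cos a * sin b + _]addrC. Qed.

Lemma cis_sg : E != 0 ->
  cis (- (3 * pi / 4) * Num.sg E) * cis (pi / 4 * Num.sg E) =
  - 'i%C * (Num.sg E)%:C.
Proof.
move=> E0; rewrite -cisD.
rewrite (_ : _ + _ = - (pi / 2) * Num.sg E); last by field.
have [E1|E1|/eqP] := ltrgt0P E; last by rewrite (negPf E0).
- by rewrite gtr0_sg// mulr1 /cis cosN sinN cos_pihalf sin_pihalf; simpc.
- by rewrite ltr0_sg// mulrN1 opprK /cis cos_pihalf sin_pihalf; simpc.
Qed.

Lemma tau0_lead : (2 <= n)%N -> E != 0 ->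
  (2 / Num.sqrt A)%:C * cis (- (3 * pi / 4) * Num.sg E) * tau0_coef R X 1 =
  (pi / (`|E| * A) * Num.sqrt (2 / (`|E| * A)))%:C.
Proof.
move=> n2 E0; rewrite tau0_coef1 i2divC.
set c1 := cis _; set c2 := cis _; set a := 2 / _; set p := _^-1.
set D := Num.sqrt (2 * _ * _); set g := (_ / 2 * _);
transitivity (c1 * c2 * 'i%C * (a * p / D * g * (2 / (pi * E)))%:C).
  by rewrite !rmorphM /= !fmorphV; ring.
rewrite cis_sg//.
have ii : 'i%C * 'i%C = -1 :> R[i] by rewrite -expr2 sqr_i.
have -> (u v : R[i]) : - 'i%C * u * 'i%C * v = - ('i%C * 'i%C) * (u * v).
  by ring.
rewrite ii opprK mul1r -rmorphM /=.
congr (_%:C).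
have Epos : 0 < `|E| by rewrite normr_gt0.
have A0 := seifert_A_gt0.
have pi0 := pi_gt0 R.
rewrite /a /p /D /g {a p D g}.
rewrite (_ : (pi : R) ^+ n = pi ^+ (n - 2) * pi ^+ 2); last first.
  by rewrite -exprD subnK.
rewrite !sqrtrM ?(ltW pi0) ?mulr_ge0 ?(ltW pi0)// sqrtrV ?mulr_ge0 ?(ltW A0)//.
rewrite sqrtrM ?normr_ge0//.
have sgE : Num.sg E / E = `|E|^-1 by rewrite -normfV normrEsg sgrV.
have s2 : 2 / Num.sqrt 2 = Num.sqrt 2 :> R.
  by rewrite -{1}(sqr_sqrtr (ler0n R 2)) expr2 mulfK// gt_eqF// sqrtr_gt0.
have -> : pi / (`|E| * A) * (Num.sqrt 2 / (Num.sqrt `|E| * Num.sqrt A)) =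
    Num.sg E / E * (2 / Num.sqrt 2) * (pi / (A * (Num.sqrt `|E| * Num.sqrt A))).
  by rewrite s2 sgE !invfM; ring.
have : Num.sqrt `|E| != 0 by rewrite gt_eqF// sqrtr_gt0.
have : Num.sqrt A != 0 by rewrite gt_eqF// sqrtr_gt0.
have : Num.sqrt 2 != 0 :> R by rewrite gt_eqF// sqrtr_gt0.
have : Num.sqrt (pi : R) != 0 by rewrite gt_eqF// sqrtr_gt0.
have : (pi : R) != 0 by rewrite gt_eqF.
have {A0} : A != 0 by rewrite gt_eqF.
move: (Num.sqrt (pi : R)) => sp; move: (pi : R) pi0 => p _.
move: (Num.sqrt `|E|) (Num.sqrt A) (Num.sqrt 2) => se sA t2.
move=> An pn spn t2n sAn sen.
have pk : p ^+ (n - 2) != 0 by rewrite expf_neq0.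
by field; rewrite E0 An pn spn t2n sAn sen.
Qed.

End TrivialConnection.

Section Expansions.
Set Implicit Arguments.
Unset Strict Implicit.
Variable F : fieldType.

Lemma fexp_seq_mono (c : F) m (f : fexp F) j :
  fexp_seq (fexp_mono c m ** f) j = c * fexp_seq f j.
Proof.
rewrite /= big_ord_recl /= subn0 big1 ?addr0// => i _.
by rewrite mul0r.
Qed.

Lemma fexp_seq_monoA (c : F) m (f g : fexp F) j :
  fexp_seq (fexp_mono c m ** f ** g) j = c * fexp_seq (f ** g) j.
Proof.
transitivity (\sum_(i < j.+1)
  fexp_seq (fexp_mono c m ** f) i * fexp_seq g (j - i)%N) => //.
by under eq_bigr do rewrite fexp_seq_mono -mulrA; rewrite -mulr_sumr.
Qed.

Lemma sum_even_index (G : nat -> F) h : (forall i, odd i -> G i = 0) ->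
  \sum_(i < h.*2.+1) G i = \sum_(i < h.+1) G i.*2.
Proof.
move=> G0; elim: h => [|h IHh]; first by rewrite !big_ord1.
rewrite doubleS big_ord_recr big_ord_recr /= IHh.
rewrite [in RHS]big_ord_recr /= doubleS.
by rewrite (G0 h.*2.+1) ?addr0//= odd_double.
Qed.

Lemma fexp_seq_rinv (k l : int) (f g : nat -> F) j :
  fexp_seq (fexp_rinv k f ** fexp_rinv l g) j =
  if odd j then 0 else \sum_(i < (j./2).+1) f i * g (j./2 - i)%N.
Proof.
rewrite /=; case: ifPn => oj.
  apply: big1 => i _; case: ifPn => oi; rewrite ?mul0r//.
  by rewrite oddB -1?ltnS// oj (negPf oi) mulr0.
have := odd_double_half j; rewrite (negPf oj) add0n.
move: (j./2) => h <- {j oj}.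
pose G i := (if odd i then 0 else f i./2) *
  (if odd (h.*2 - i) then 0 else g (h.*2 - i)./2).
rewrite (sum_even_index (G := G)); last by move=> i oi; rewrite /G oi mul0r.
by apply: eq_bigr => i _; rewrite /G -doubleB !odd_double !doubleK.
Qed.

Lemma fexp_eq_rinv (K : nat) (f g : fexp F) (u w : nat -> F) :
  fexp_ord f = 1 - K%:Z *+ 2 -> fexp_ord g = 3 ->
  (forall j, fexp_seq f j = if odd j then 0 else u j./2) ->
  (forall j, fexp_seq g j = if odd j then 0 else w j./2) ->
  (forall l, (l <= K)%N -> u l = 0) -> (forall l, u (K.+1 + l)%N = w l) ->
  f ~~~ g.
Proof.
move=> fo go fu gw u0 uw m; rewrite /fexp_coef fo go fu gw.
have [m3|m3] := lerP 3 m; last first.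
  case: ifP => // om; rewrite u0 ?if_same//.
  lia.
rewrite ifT; last by lia.
have -> : `|(m - (1 - K%:Z *+ 2))%R|%N = (`|(m - 3)%R|%N + K.+1.*2)%N by lia.
by rewrite oddD odd_double addbF halfD odd_double andbF doubleK add0n addnC uw.
Qed.

End Expansions.

Theorem mainTheorem6 (R : realType) (X : seifert)
    (n_ge3 : (3 <= sf_n X)%N) (E_neq0 : seifert_euler R X != 0) :
  let E := seifert_euler R X in
  let A := seifert_A R X in
  exists b : nat -> R[i],
    tau0 R X ~~~
      fexp_mono (pi / (`|E| * A) * Num.sqrt (2 / (`|E| * A)))%:C 3
      ** fexp_rinv 0 (fun k =>
           if k == 0%N then 1
           else if k == 1%N then 6 * pi%:C * 'i%C * (casson_walker R X)%:C
           else b k).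
Proof.
move=> E A; have n2 : (2 <= sf_n X)%N by exact: ltnW.
pose K := ((sf_n X - 2) %/ 2)%N.
have A0 : 0 < A by exact: seifert_A_gt0.
have E0 : 0 < `|E| by rewrite normr_gt0.
pose c : R[i] := (2 / Num.sqrt A)%:C * cis (- (3 * pi / 4) * Num.sg E).
pose x : R := 3 * Num.sg E - E -
  \sum_j dedekind_symbol R (@sf_beta X j) (@sf_alpha X j).
pose a : R[i] := 'i%C * (pi / 2 * x)%:C.
pose s j := tau0_coef R X (tau0_k1 X + j%:Z).
pose u l := c * \sum_(i < l.+1) a ^+ i / i`!%:R * s (l - i)%N.
set d : R[i] := (_ * _)%:C.
have d0 : d != 0.
  rewrite /d fmorph_eq0 mulf_neq0// gt_eqF//.
    by rewrite divr_gt0 ?pi_gt0// mulr_gt0.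
  by rewrite sqrtr_gt0 divr_gt0// mulr_gt0.
have s0 j : (j <= K)%N -> s j = 0 by exact: tau0_coef_eq0.
have s1 : c * s K.+1 = d.
  have k1 : tau0_k1 X + K.+1%:Z = 1 by rewrite /tau0_k1 -/K; lia.
  by rewrite /s k1; exact: tau0_lead.
(* As [k_1 + K = 0], the entries [s K.+1] and [s K.+2] are [c_1] and [c_2]. *)
have s2 : s K.+2 = s K.+1 * ('i%C * (3 * tau0_quad X / (pi * E))%:C).
  have k1 : tau0_k1 X + K.+1%:Z = 1 by rewrite /tau0_k1 -/K; lia.
  have k2 : tau0_k1 X + K.+2%:Z = 2 by rewrite /tau0_k1 -/K; lia.
  by rewrite /s k1 k2; exact: tau0_coef2.
exists (fun k => u (K.+1 + k)%N / d).
set g := (fun k => if k == 0%N then 1 else _).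
apply: (@fexp_eq_rinv _ K _ _ u (fun l => d * g l)) => //.
- by rewrite /= /tau0_k1 -/K; lia.
- by move=> j; rewrite fexp_seq_monoA fexp_seq_rinv; case: odd; rewrite ?mulr0.
- by move=> j; rewrite fexp_seq_mono /=; case: odd; rewrite ?mulr0.
- move=> l lK; rewrite /u big1 ?mulr0// => i _.
  by rewrite s0 ?mulr0// (leq_trans (leq_subr _ _)).
case=> [|[|l]] /=; last by rewrite mulrC divfK.
- rewrite addn0 /u big_ord_recl subn0 expr0 fact0 divr1 mul1r.
  rewrite big1 ?addr0 ?mulr1//.
  by move=> i _; rewrite s0 ?mulr0//= /bump /=; lia.
- rewrite addn1 /u big_ord_recl big_ord_recl big1 ?addr0; last first.
    by move=> i _; rewrite s0 ?mulr0//= /bump /=; lia.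
  rewrite /= /bump /= subn0 addn0 subn1 /= expr0 expr1 !divr1 mul1r s2.
  transitivity (c * s K.+1 * 'i%C *
      (3 * tau0_quad X / (pi * E) + pi / 2 * x)%:C).
    by rewrite /a rmorphD /=; ring.
  rewrite s1 -mulrA; congr (_ * _).
  have -> : 3 * tau0_quad X / (pi * E) + pi / 2 * x =
      6 * pi * casson_walker R X.
    rewrite /casson_walker -/E -/x /tau0_quad.
    have : (pi : R) != 0 by rewrite gt_eqF ?pi_gt0.
    move: (pi : R) => p p0; field.
    exact/andP.
  by rewrite /g /= !rmorphM /= rmorph_nat; ring.
Qed.
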